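(* Let $D$ be an oriented bipartite graph with bipartition $(A,B)$, where $|A|=m\geq 2$ and $|B|=n\geq 2$. Suppose that $d^{+}(u)\geq n/3$ for each $u\in A$ and $d^{+}(v)\geq m/3$ for each $v\in B$. Then either $D$ contains a directed cycle of length $4$, or $m$ and $n$ are both divisible by $3$ and $D$ is isomorphic to $D^*(m,n)$.
   Context: An oriented graph is a finite simple graph (no loops, no multiple edges) in which each edge is replaced by exactly one arc (so there are no 2-cycles); $d^{+}(w)$ denotes the out-degree of a vertex $w$. An oriented bipartite graph with bipartition $(A,B)$ is an oriented graph whose underlying graph is bipartite with parts $A$ and $B$. For positive integers $m,n$ divisible by $3$, $D^*(m,n)$ denotes the following oriented bipartite graph with bipartition $(M,N)$: $M=M_0\cup M_1\cup M_2$ and $N=N_0\cup N_1\cup N_2$ are disjoint unions with $|M_0|=|M_1|=|M_2|=m/3$ and $|N_0|=|N_1|=|N_2|=n/3$, and the arcs are exactly all arcs from $M_i$ to $N_i$ and all arcs from $N_i$ to $M_{i+1}$, for $i=0,1,2$ (indices modulo $3$). *)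

(* Defs.v *)
From mathcomp Require Import all_boot.

Set Implicit Arguments.
Unset Strict Implicit.
Unset Printing Implicit Defensive.

(* [e x y] is the arc from [x] to [y]. Taking [x = y] also excludes loops. *)
Definition oriented (V : finType) (e : rel V) : Prop :=
  forall x y : V, e x y -> ~~ e y x.

Definition bipartition (V : finType) (e : rel V) (A B : {set V}) : Prop :=
  [/\ A :|: B = [set: V], [disjoint A & B]
    & forall x y : V, e x y ->
        (x \in A) && (y \in B) || (x \in B) && (y \in A)].

Definition outdeg (V : finType) (e : rel V) (x : V) : nat :=
  #|[set y | e x y]|.

Definition has_dicycle (V : finType) (e : rel V) (k : nat) : Prop :=
  exists c : seq V, ucycle e c /\ size c = k.

Definition digraph_iso (V W : finType) (e : rel V) (e' : rel W) : Prop :=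
  exists f : V -> W, bijective f /\ forall x y : V, e' (f x) (f y) = e x y.

(* [inl (i, _)] is a vertex of M_i and [inr (i, _)] one of N_i; [ordS] is the
   successor modulo 3. The parts have total sizes m and n only when 3 divides
   m and n. *)
Definition Dstar_vertex (m n : nat) : finType :=
  ('I_3 * 'I_(m %/ 3) + 'I_3 * 'I_(n %/ 3))%type.

Definition Dstar (m n : nat) : rel (Dstar_vertex m n) := fun x y =>
  match x, y with
  | inl (i, _), inr (j, _) => j == i
  | inr (i, _), inl (j, _) => j == ordS i
  | _, _ => false
  end.

(* Main.v *)
(** Discard arcs until all out-degrees are k = ceil(m/3) on B and l = ceil(n/3)
    on A. Without directed 4-cycles, two vertices v, v' of B cannot have both an
    arc from N(v') to v and an arc from N(v) to v', so the number of arcs from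
    N(v') to v, the number of arcs from N(v) to v' and |N(v) /\ N(v')| add up to
    at most k. Summing over all pairs gives 2nkl + sum_x d^-(x)^2 <= k n^2, x
    ranging over A, and Cauchy-Schwarz then forces m = 3k, n = 3l and equality
    for every pair. Equality makes the out-neighbours of any vertex share their
    out-neighbourhood, from which the blow-up of the directed 6-cycle can be read
    off; putting back any discarded arc would create a 4-cycle. *)
Require Import Defs.
From mathcomp Require Import all_boot.
From mathcomp Require Import zify.

Set Implicit Arguments.
Unset Strict Implicit.
Unset Printing Implicit Defensive.

(** * Closed walks of length four *)

(** Without distinctness of the vertices, the condition passes to subgraphs at once and can be
    refuted by exhibiting four arcs. *)
Definition no_closed_4walk (V : finType) (e : rel V) : Prop :=
  forall a b c d : V, e a b -> e b c -> e c d -> ~~ e d a.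

Definition outset (V : finType) (e : rel V) (x : V) : {set V} := [set y | e x y].
Definition inset (V : finType) (e : rel V) (x : V) : {set V} := [set y | e y x].

(** On a closed 4-walk, adjacent vertices differ because there are no loops, and opposite ones
    because there are no 2-cycles; so the walk is a cycle. *)
Lemma dicycle4_or_no_closed_4walk (V : finType) (e : rel V) :
  oriented e -> has_dicycle e 4 \/ no_closed_4walk e.
Proof.
move=> he.
case: (boolP [exists a, exists b, exists c, exists d, [&& e a b, e b c, e c d & e d a]]).
  move=> /existsP[a] /existsP[b] /existsP[c] /existsP[d] /and4P[ab bc cd da]; left.
  have neq x y : e x y -> x != y.
    by move=> xy; apply: contraL (xy) => /eqP E; move: (he _ _ xy); rewrite E.
  have neq2 x y z : e x y -> e y z -> x != z.
    by move=> xy yz; apply/eqP => E; move: (he _ _ xy); rewrite E yz.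
  exists [:: a; b; c; d]; split=> //; apply/andP; split.
    by rewrite /= ab bc cd da.
  rewrite /= !inE !negb_or (neq _ _ ab) (neq _ _ bc) (neq _ _ cd).
  by rewrite (neq2 _ _ _ ab bc) (neq2 _ _ _ bc cd) eq_sym (neq _ _ da).
move=> /existsP no4; right=> a b c d ab bc cd; apply/negP => da; apply: no4.
exists a; apply/existsP; exists b; apply/existsP; exists c; apply/existsP; exists d.
by apply/and4P.
Qed.

(** A 2-cycle run through twice, or a loop run through four times, is a closed 4-walk. *)
Lemma no_closed_4walk_oriented (V : finType) (e : rel V) :
  no_closed_4walk e -> oriented e.
Proof. by move=> no4 x y xy; apply/negP => yx; move: (no4 _ _ _ _ xy yx xy); rewrite yx. Qed.

(** * Inequalities between finite sums *)

(** Twice the square expands into terms [2 * (f x * f y)], each at most [f x ^ 2 + f y ^ 2]. *)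
Lemma sum_cauchy (I : finType) (A : {set I}) (f : I -> nat) :
  (\sum_(x in A) f x) ^ 2 <= #|A| * \sum_(x in A) f x ^ 2.
Proof.
rewrite -(leq_pmul2l (isT : 0 < 2)) -mulnn big_distrlr /= big_distrr /=.
have -> : 2 * (#|A| * \sum_(x in A) f x ^ 2) =
    \sum_(x in A) \sum_(y in A) (f x ^ 2 + f y ^ 2).
  rewrite [RHS](eq_bigr (fun x => #|A| * f x ^ 2 + \sum_(y in A) f y ^ 2)); last first.
    by move=> x _; rewrite big_split /= sum_nat_const.
  by rewrite big_split /= -big_distrr /= sum_nat_const mul2n addnn.
apply: leq_sum => x _; rewrite big_distrr /=; apply: leq_sum => y _.
exact: nat_Cauchy.
Qed.

Lemma eq_of_leq_sum (I : finType) (P : pred I) (F G : I -> nat) :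
  (forall i, P i -> F i <= G i) -> \sum_(i | P i) G i <= \sum_(i | P i) F i ->
  forall i, P i -> F i = G i.
Proof.
move=> FG GF i Pi; apply/eqP; rewrite eqn_leq FG //=.
move: GF; rewrite (bigD1 i) //= [X in _ <= X](bigD1 i) //=.
have := @leq_sum _ (index_enum I) (fun j => P j && (j != i)) F G.
by move=> /(_ (fun j Pj => FG j (proj1 (andP Pj)))); lia.
Qed.

(** * Double counting over pairs of vertices, and its equality case *)

Lemma card_sum_mem (V : finType) (A : {set V}) : #|A| = \sum_x (x \in A).
Proof. by rewrite -sum1_card big_mkcond; apply: eq_bigr => x _; case: ifP. Qed.

(* An arc N(v') -> v together with an arc N(v) -> v' would close a 4-walk, so
   one of the first two terms vanishes. *)
Lemma pair_bound (V : finType) (e : rel V) (k : nat) (v v' : V) :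
  no_closed_4walk e -> outdeg e v = k -> outdeg e v' = k ->
  #|outset e v' :&: inset e v| + #|outset e v :&: inset e v'|
    + #|outset e v :&: outset e v'| <= k.
Proof.
move=> no4; have he := no_closed_4walk_oriented no4.
(* Both sets lie in N(w'), and a common element would form a 2-cycle with [w]. *)
have half w w' : outdeg e w' = k ->
    #|outset e w' :&: inset e w| + #|outset e w :&: outset e w'| <= k.
  move=> <-; rewrite -cardsUI (_ : _ :&: _ :&: _ = set0) ?cards0 ?addn0.
    by apply: subset_leq_card; apply/subsetP => x; rewrite !inE => /orP[] /andP[].
  apply/setP => x; rewrite !inE; case xw: (e x w); rewrite ?andbF //.
  by rewrite (negPf (he _ _ xw)) andbF.
move=> dv dv'; case: (set_0Vmem (outset e v :&: inset e v')) => [-> | [x]].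
  by rewrite cards0 addn0; apply: half.
rewrite !inE => /andP[vx xv'].
rewrite (_ : outset e v' :&: inset e v = set0).
  by rewrite cards0 add0n [outset e v :&: outset e v']setIC half.
apply/setP => y; rewrite !inE; apply/negP => /andP[v'y yv].
by move: (no4 _ _ _ _ vx xv' v'y); rewrite yv.
Qed.

Lemma bipartition_sym (V : finType) (e : rel V) (A B : {set V}) :
  bipartition e A B -> bipartition e B A.
Proof.
case=> AB dAB arcs; split; first by rewrite setUC.
  by rewrite disjoint_sym.
by move=> x y /arcs; rewrite orbC.
Qed.

Lemma bipartition_arc (V : finType) (e : rel V) (A B : {set V}) (x y : V) :
  bipartition e A B -> e x y -> x \in A -> y \in B.
Proof.
case=> _ dAB arcs /arcs /orP[/andP[] // | /andP[xB _] xA].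
by rewrite (disjointFr dAB xA) in xB.
Qed.

(** Both sides count the walks v' -> x -> v: [v'] is free in [B], then there are [k] choices for [x]
    and [l] for [v]. *)
Lemma sum_outset_inset (V : finType) (e : rel V) (A B : {set V}) (k l : nat) :
  bipartition e A B ->
  (forall u, u \in A -> outdeg e u = l) -> (forall v, v \in B -> outdeg e v = k) ->
  \sum_(v in B) \sum_(v' in B) #|outset e v' :&: inset e v| = #|B| * (k * l).
Proof.
move=> bip dA dB; rewrite exchange_big /= -sum_nat_const.
apply: eq_bigr => v' v'B.
rewrite (eq_bigr (fun v => \sum_(x in outset e v') (e x v : nat))); last first.
  move=> v _; rewrite card_sum_mem [RHS]big_mkcond; apply: eq_bigr => x _.
  by rewrite !inE; case: (e v' x).
rewrite exchange_big /= -(dB _ v'B) -sum_nat_const; apply: eq_bigr => x.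
rewrite inE => v'x; have xA := bipartition_arc (bipartition_sym bip) v'x v'B.
rewrite -(dA _ xA) /outdeg card_sum_mem big_mkcond; apply: eq_bigr => y _.
rewrite inE; case xy: (e x y); last by case: ifP.
by rewrite (bipartition_arc bip xy xA).
Qed.

(** Both sides count the triples (v, v', x) with arcs from [v] and [v'] to [x]; the inner sum on the
    right is the in-degree of [x]. *)
Lemma sum_outsetI (V : finType) (e : rel V) (A B : {set V}) :
  bipartition e A B ->
  \sum_(v in B) \sum_(v' in B) #|outset e v :&: outset e v'|
    = \sum_(x in A) (\sum_(v in B) e v x) ^ 2.
Proof.
move=> bip; under eq_bigr => v vB.
  under eq_bigr => v' _.
    have -> : #|outset e v :&: outset e v'| = \sum_(x in A) e v x * e v' x.
      rewrite card_sum_mem [RHS]big_mkcond; apply: eq_bigr => x _.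
      rewrite !inE mulnb; case vx: (e v x); last by case: ifP.
      by rewrite (bipartition_arc (bipartition_sym bip) vx vB).
    over.
  rewrite exchange_big /=.
  over.
rewrite exchange_big /=; apply: eq_bigr => x _.
by rewrite -mulnn big_distrlr.
Qed.

Lemma sum_indeg (V : finType) (e : rel V) (A B : {set V}) (k : nat) :
  bipartition e A B -> (forall v, v \in B -> outdeg e v = k) ->
  \sum_(x in A) \sum_(v in B) e v x = #|B| * k.
Proof.
move=> bip dB; rewrite exchange_big /= -sum_nat_const; apply: eq_bigr => v vB.
rewrite -(dB _ vB) /outdeg card_sum_mem big_mkcond; apply: eq_bigr => x _.
rewrite inE; case vx: (e v x); last by case: ifP.
by rewrite (bipartition_arc (bipartition_sym bip) vx vB).
Qed.

Lemma pair_count (V : finType) (e : rel V) (A B : {set V}) (k l : nat) :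
  no_closed_4walk e -> bipartition e A B ->
  (forall u, u \in A -> outdeg e u = l) -> (forall v, v \in B -> outdeg e v = k) ->
  0 < #|A| -> 0 < #|B| -> #|A| <= 3 * k -> #|B| <= 3 * l ->
  [/\ #|A| = 3 * k, #|B| = 3 * l &
    forall v v', v \in B -> v' \in B ->
      #|outset e v' :&: inset e v| + #|outset e v :&: inset e v'|
        + #|outset e v :&: outset e v'| = k].
Proof.
move=> no4 bip dA dB A0 B0 hk hl.
set F := fun v v' => #|outset e v' :&: inset e v| + #|outset e v :&: inset e v'|
        + #|outset e v :&: outset e v'|.
have Fk v v' : v \in B -> v' \in B -> F v v' <= k.
  by move=> vB v'B; apply: pair_bound => //; apply: dB.
have sumF : \sum_(v in B) \sum_(v' in B) F v v' =
    2 * (#|B| * (k * l)) + \sum_(x in A) (\sum_(v in B) e v x) ^ 2.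
  rewrite /F; under eq_bigr => v _ do rewrite 2!big_split /=.
  rewrite 2!big_split /= (sum_outset_inset bip dA dB) exchange_big /=.
  by rewrite (sum_outset_inset bip dA dB) (sum_outsetI bip) mul2n addnn.
have sumk : \sum_(v in B) \sum_(v' in B) k = #|B| * (#|B| * k).
  by rewrite -sum_nat_const; apply: eq_bigr => v _; rewrite sum_nat_const.
have le_sum : \sum_(v in B) \sum_(v' in B) F v v' <= \sum_(v in B) \sum_(v' in B) k.
  by apply: leq_sum => v vB; apply: leq_sum => v' v'B; apply: Fk.
have := sum_cauchy A (fun x => \sum_(v in B) e v x).
rewrite (sum_indeg bip dB); move: le_sum; rewrite sumF sumk => le_sum cauchy.
have k0 : 0 < k by lia.
set Q := \sum_(x in A) _ in sumF le_sum cauchy.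
(* Write m = |A|, n = |B|. Multiply [le_sum] by m, bound mQ below by (nk)^2 using [cauchy], and
   cancel nk. Since m <= 3k and n <= 3l, the left side is also at least mn, which forces both
   equalities below. *)
have key : 2 * l * #|A| + #|B| * k <= #|B| * #|A|.
  have : #|B| * k * (2 * l * #|A| + #|B| * k) <= #|B| * k * (#|B| * #|A|) by nia.
  by rewrite leq_pmul2l // muln_gt0 B0.
have mk : #|A| = 3 * k by nia.
have nl : #|B| = 3 * l by nia.
split=> // v v' vB v'B.
(* Now [cauchy] reads Q >= 3kl^2, so the total is at least 6kl^2 + 3kl^2 = kn^2. *)
have ge_sum : \sum_(v in B) \sum_(v' in B) k <= \sum_(v in B) \sum_(v' in B) F v v'.
  have : k * (3 * (l * l * k)) <= k * Q.
    by move: cauchy; rewrite -mulnn mk nl; nia.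
  by rewrite leq_pmul2l // sumF sumk -/Q nl; nia.
(* Equality of the totals descends first to the rows, then to the single entries. *)
have E := eq_of_leq_sum (fun w wB => leq_sum _ (fun w' w'B => Fk w w' wB w'B)) ge_sum.
apply: (eq_of_leq_sum (fun w' w'B => Fk v w' vB w'B) _ v'B).
by rewrite (E v vB).
Qed.

(* By tightness of the pair count, N(v) and N(N(v)) span a bipartite tournament;
   having no 4-cycle, it has nested, hence equal, out-neighbourhoods on N(v). *)
Lemma out_twins (V : finType) (e : rel V) (A B : {set V}) (k l : nat) (v x y : V) :
  no_closed_4walk e -> bipartition e A B ->
  (forall u, u \in A -> outdeg e u = l) -> (forall v, v \in B -> outdeg e v = k) ->
  (forall v v', v \in B -> v' \in B ->
      #|outset e v' :&: inset e v| + #|outset e v :&: inset e v'|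
        + #|outset e v :&: outset e v'| = k) ->
  v \in B -> e v x -> e v y -> outset e x = outset e y.
Proof.
move=> no4 bip dA dB tight vB.
have bip' := bipartition_sym bip.
have adj a b w : e v a -> e v b -> e a w -> ~~ e b w -> e w b.
  move=> va vb aw nbw.
  have wB : w \in B := bipartition_arc bip aw (bipartition_arc bip' va vB).
  have := tight _ _ vB wB.
  rewrite (_ : outset e w :&: inset e v = set0); last first.
    apply/setP => z; rewrite !inE; apply/negP => /andP[wz zv].
    by move: (no4 _ _ _ _ va aw wz); rewrite zv.
  rewrite cards0 add0n -cardsUI (_ : _ :&: _ :&: _ = set0); last first.
    apply/setP => z; rewrite !inE; case zw: (e z w); rewrite ?andbF //.
    by rewrite (negPf (no_closed_4walk_oriented no4 zw)) !andbF.
  rewrite cards0 addn0 -setIUr -(dB _ vB) => E.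
  have /eqP sub : outset e v :&: (inset e w :|: outset e w) == outset e v.
    by rewrite eqEcard subsetIl E leqnn.
  have : b \in outset e v by rewrite inE.
  by rewrite -sub !inE (negPf nbw) => /andP[].
move=> vx vy.
have xA := bipartition_arc bip' vx vB; have yA := bipartition_arc bip' vy vB.
have cardxy : #|outset e x| = #|outset e y|.
  by rewrite -/(outdeg e x) -/(outdeg e y) !dA.
(* Sets of equal size that differ each have an element outside the other. The resulting [w] and [w']
   close the walk x -> w -> y -> w' -> x by [adj]. *)
apply/eqP; rewrite eqEcard cardxy leqnn andbT; apply/negPn/negP => nsub.
have /subsetPn[w'] : ~~ (outset e y \subset outset e x).
  by apply: contra nsub => sub; have /eqP -> : outset e y == outset e x
    by rewrite eqEcard sub cardxy /=.
case/subsetPn: nsub => w; rewrite !inE => xw nyw yw' nxw'.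
have wy := adj _ _ _ vx vy xw nyw; have w'x := adj _ _ _ vy vx yw' nxw'.
by move: (no4 _ _ _ _ xw wy yw'); rewrite w'x.
Qed.

(** * Colourings that describe D* *)

(** The colour is the index of the part M_i or N_i. Positions inside a part are left out, since they
    do not influence the arcs. *)
Definition Dstar_coloring (V : finType) (e : rel V) (A B : {set V}) (c : V -> 'I_3) :=
  forall x y, e x y = [|| [&& x \in A, y \in B & c y == c x]
                        | [&& x \in B, y \in A & c y == ordS (c x)]].

(** Any numbering of each colour class gives an isomorphism; the one used is the rank in the
    enumeration of the class. *)
Lemma Dstar_iso (V : finType) (e : rel V) (A B : {set V}) (c : V -> 'I_3) (k l : nat) :
  A :|: B = [set: V] -> [disjoint A & B] -> 0 < k -> 0 < l ->
  (forall i, #|[set x in A | c x == i]| = k) ->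
  (forall i, #|[set x in B | c x == i]| = l) ->
  Dstar_coloring e A B c -> digraph_iso e (@Dstar (3 * k) (3 * l)).
Proof.
move=> AB dAB k0 l0 cA cB col.
have k0' : 0 < 3 * k %/ 3 by rewrite mulKn.
have l0' : 0 < 3 * l %/ 3 by rewrite mulKn.
pose rk (X : {set V}) x := index x (enum [set y in X | c y == c x]).
(* The default values of [insubd] are never taken on the relevant side, because [rk_lt] keeps the
   rank in range. *)
pose f x : Dstar_vertex (3 * k) (3 * l) :=
  if x \in A then inl (c x, insubd (Ordinal k0') (rk A x))
  else inr (c x, insubd (Ordinal l0') (rk B x)).
have inB x : x \notin A -> x \in B.
  by move=> nA; have := in_setT x; rewrite -AB inE (negPf nA).
have rk_inj (X : {set V}) x y :
    x \in X -> y \in X -> c x = c y -> rk X x = rk X y -> x = y.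
  move=> xX yX cxy; rewrite /rk cxy => E.
  have xs : x \in enum [set z in X | c z == c y] by rewrite mem_enum inE xX cxy eqxx.
  have ys : y \in enum [set z in X | c z == c y] by rewrite mem_enum inE yX eqxx.
  by rewrite -(nth_index x xs) E (nth_index x ys).
have rk_lt (X : {set V}) p x :
    (forall i, #|[set x in X | c x == i]| = p) -> x \in X -> rk X x < 3 * p %/ 3.
  by move=> cX xX; rewrite mulKn // -(cX (c x)) cardE index_mem mem_enum inE xX eqxx.
have f_inj : injective f.
  move=> x y; rewrite /f; case: ifPn => xA; case: ifPn => yA // [cxy].
    move/(congr1 val); rewrite !insubdK ?unfold_in ?rk_lt //; exact: rk_inj.
  have xB := inB _ xA; have yB := inB _ yA.
  move/(congr1 val); rewrite !insubdK ?unfold_in ?rk_lt //; exact: rk_inj.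
exists f; split.
  (* It suffices to compare sizes: the target has 3k + 3l = |A| + |B| vertices. *)
  apply: inj_card_bij => //.
  have card3 (X : {set V}) p : (forall i, #|[set x in X | c x == i]| = p) -> #|X| = 3 * p.
    move=> cX; rewrite -sum1_card (partition_big c predT) //= -[3 in RHS]card_ord.
    rewrite -sum_nat_const; apply: eq_bigr => i _; rewrite -(cX i) -sum1_card.
    by apply: eq_bigl => x; rewrite inE.
  rewrite card_sum !card_prod !card_ord !mulKn // -(card3 _ _ cA) -(card3 _ _ cB).
  rewrite -cardsUI (disjoint_setI0 dAB) cards0 addn0.
  exact: max_card.
move=> x y; rewrite col /f.
case: ifPn => xA; case: ifPn => yA /=.
- by rewrite (disjointFr dAB xA) (disjointFr dAB yA).
- by rewrite (disjointFr dAB xA) inB ?orbF.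
- by rewrite inB.
- by rewrite andbF.
Qed.

(* An additional arc would either reverse an existing one or close a 4-walk. *)
Lemma Dstar_coloring_maximal (V : finType) (e e' : rel V) (A B : {set V}) (c : V -> 'I_3) :
  no_closed_4walk e -> bipartition e A B -> subrel e' e ->
  (forall i, exists2 x, x \in A & c x = i) -> (forall i, exists2 x, x \in B & c x = i) ->
  Dstar_coloring e' A B c -> Dstar_coloring e A B c.
Proof.
move=> no4 [AB dAB arcs] sub neA neB col x y; rewrite -col.
apply/idP/idP; last exact: sub.
have he := no_closed_4walk_oriented no4.
have ord3 (i j : 'I_3) : [|| j == i, j == ordS i | i == ordS j].
  by case: i => [[|[|[|?]]] ?] //; case: j => [[|[|[|?]]] ?].
have ordS3 (i : 'I_3) : ordS (ordS (ordS i)) = i.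
  by apply: val_inj; case: i => [[|[|[|?]]] ?].
have AtoB a b : a \in A -> b \in B -> c b = c a -> e a b.
  by move=> aA bB cab; apply: sub; rewrite col aA bB cab eqxx.
have BtoA a b : a \in A -> b \in B -> c a = ordS (c b) -> e b a.
  by move=> aA bB cab; apply: sub; rewrite col aA bB cab eqxx orbT.
(* Consider the colour of [y] minus that of [x], modulo 3. From [A] to [B], 0 is right, 1 closes a
   4-walk and 2 reverses an arc; from [B] to [A], 1 is right, 2 closes a 4-walk and 0 reverses an
   arc. *)
move=> xy; case/orP: (arcs _ _ xy) => /andP[xX yX]; rewrite col xX yX /=.
- case/or3P: (ord3 (c x) (c y)) => [-> // | /eqP cy | /eqP cx].
    have [u uA cu] := neA (ordS (c y)); have [w wB cw] := neB (ordS (c y)).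
    have yu := BtoA _ _ uA yX cu.
    have uw : e u w by apply: AtoB => //; rewrite cu.
    by move: (no4 _ _ _ _ xy yu uw); rewrite BtoA // cw cy ordS3.
  by move: (he _ _ xy); rewrite BtoA.
- case/or3P: (ord3 (c x) (c y)) => [/eqP cy | -> | /eqP cx]; last 2 first.
  + by rewrite orbT.
  + have [w wB cw] := neB (c y); have [u uA cu] := neA (c x).
    have yw := AtoB _ _ yX wB cw.
    have wu : e w u by apply: BtoA => //; rewrite cu cw.
    by move: (no4 _ _ _ _ xy yw wu); rewrite AtoB.
  by move: (he _ _ xy); rewrite AtoB.
Qed.

(** * Reading off the six classes from twin out-neighbourhoods *)

Lemma setU3_card (V : finType) (X X1 X2 X3 : {set V}) (p : nat) :
  #|X| = 3 * p -> #|X1| = p -> #|X2| = p -> #|X3| = p ->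
  X1 \subset X -> X2 \subset X -> X3 \subset X ->
  X1 :&: X2 = set0 -> X1 :&: X3 = set0 -> X2 :&: X3 = set0 -> X = X1 :|: X2 :|: X3.
Proof.
move=> cX c1 c2 c3 s1 s2 s3 i12 i13 i23; apply/esym/eqP.
rewrite eqEcard !subUset s1 s2 s3 /=.
rewrite cardsU setIUl i13 i23 setU0 cards0 cardsU i12 cards0 !subn0 cX c1 c2 c3.
by lia.
Qed.

(** Follow a walk v0 x1 w1 x2 w2 x3 w3. The out-neighbourhoods of its first six vertices are the
    classes: by [twins] each class sends all its arcs onto the next, and by size they exhaust [A]
    and [B]. It remains to see that the last class leads back to the first. *)
Lemma twins_Dstar_coloring (V : finType) (e : rel V) (A B : {set V}) (k l : nat) :
  no_closed_4walk e -> bipartition e A B -> 0 < k -> 0 < l ->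
  #|A| = 3 * k -> #|B| = 3 * l ->
  (forall u, u \in A -> outdeg e u = l) -> (forall v, v \in B -> outdeg e v = k) ->
  (forall v x y, e v x -> e v y -> outset e x = outset e y) ->
  exists2 c : V -> 'I_3, Dstar_coloring e A B c &
    (forall i, #|[set x in A | c x == i]| = k) /\
    (forall i, #|[set x in B | c x == i]| = l).
Proof.
move=> no4 bip k0 l0 cA cB dA dB twins.
have bip' := bipartition_sym bip; have he := no_closed_4walk_oriented no4.
have [_ dAB _] := bip.
have exA v : v \in B -> exists2 x, e v x & x \in A.
  move=> vB; have : 0 < #|outset e v| by rewrite [#|_|](dB v vB).
  by case/card_gt0P=> x; rewrite inE => vx; exists x => //; apply: bipartition_arc bip' vx vB.
have exB u : u \in A -> exists2 y, e u y & y \in B.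
  move=> uA; have : 0 < #|outset e u| by rewrite [#|_|](dA u uA).
  by case/card_gt0P=> y; rewrite inE => uy; exists y => //; apply: bipartition_arc bip uy uA.
have [v0 v0B] : exists v, v \in B by apply/card_gt0P; rewrite cB; lia.
have [x1 v0x1 x1A] := exA _ v0B; have [w1 x1w1 w1B] := exB _ x1A.
have [x2 w1x2 x2A] := exA _ w1B; have [w2 x2w2 w2B] := exB _ x2A.
have [x3 w2x3 x3A] := exA _ w2B; have [w3 x3w3 w3B] := exB _ x3A.
have outA v x : v \in B -> x \in outset e v -> x \in A.
  by move=> vB; rewrite inE => vx; apply: bipartition_arc bip' vx vB.
have outB u y : u \in A -> y \in outset e u -> y \in B.
  by move=> uA; rewrite inE => uy; apply: bipartition_arc bip uy uA.
pose S1 := outset e v0; pose S2 := outset e w1; pose S3 := outset e w2.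
pose O1 := outset e x1; pose O2 := outset e x2; pose O3 := outset e x3.
have SO1 x : x \in S1 -> outset e x = O1 by rewrite inE => h; apply: twins h v0x1.
have SO2 x : x \in S2 -> outset e x = O2 by rewrite inE => h; apply: twins h w1x2.
have SO3 x : x \in S3 -> outset e x = O3 by rewrite inE => h; apply: twins h w2x3.
have OS1 y : y \in O1 -> outset e y = S2 by rewrite inE => h; apply: twins h x1w1.
have OS2 y : y \in O2 -> outset e y = S3 by rewrite inE => h; apply: twins h x2w2.
have arc x y Y : outset e x = Y -> y \in Y -> e x y by move=> <-; rewrite inE.
have x1S : x1 \in S1 by rewrite inE.
have x2S : x2 \in S2 by rewrite inE.
have x3S : x3 \in S3 by rewrite inE.
have w1O : w1 \in O1 by rewrite inE.
have w2O : w2 \in O2 by rewrite inE.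
have w3O : w3 \in O3 by rewrite inE.
have disj (X Y : {set V}) : (forall z, z \in X -> z \in Y -> False) -> X :&: Y = set0.
  by move=> h; apply/setP => z; rewrite !inE; apply/negP => /andP[/h].
(* A vertex common to consecutive classes on one side would lie on a 2-cycle; one common to the
   first and third would lie on a closed 4-walk. *)
have S12 : S1 :&: S2 = set0.
  apply: disj => z z1 z2; have zw := arc _ _ _ (SO1 _ z1) w1O.
  by have := he _ _ zw; rewrite (arc _ _ _ (OS1 _ w1O) z2).
have O12 : O1 :&: O2 = set0.
  apply: disj => z z1 z2; have zw := arc _ _ _ (OS1 _ z1) x2S.
  by have := he _ _ zw; rewrite (arc _ _ _ (SO2 _ x2S) z2).
have S23 : S2 :&: S3 = set0.
  apply: disj => z z1 z2; have zw := arc _ _ _ (SO2 _ z1) w2O.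
  by have := he _ _ zw; rewrite (arc _ _ _ (OS2 _ w2O) z2).
have O23 : O2 :&: O3 = set0.
  apply: disj => z z1 z2; have zw := arc _ _ _ (OS2 _ z1) x3S.
  by have := he _ _ zw; rewrite (arc _ _ _ (SO3 _ x3S) z2).
have S13 : S1 :&: S3 = set0.
  apply: disj => z z1 z3.
  have := no4 _ _ _ _ (arc _ _ _ (SO1 _ z1) w1O) (arc _ _ _ (OS1 _ w1O) x2S) x2w2.
  by rewrite (arc _ _ _ (OS2 _ w2O) z3).
have O13 : O1 :&: O3 = set0.
  apply: disj => z z1 z3.
  have := no4 _ _ _ _ (arc _ _ _ (OS1 _ z1) x2S) x2w2 w2x3.
  by rewrite (arc _ _ _ (SO3 _ x3S) z3).
have cS w : w \in B -> #|outset e w| = k by move/dB.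
have cO u : u \in A -> #|outset e u| = l by move/dA.
have subA w : w \in B -> outset e w \subset A by move=> wB; apply/subsetP => x; apply: outA.
have subB u : u \in A -> outset e u \subset B by move=> uA; apply/subsetP => x; apply: outB.
have AE : A = S1 :|: S2 :|: S3.
  by apply: (setU3_card cA) => //; rewrite ?cS ?subA.
have BE : B = O1 :|: O2 :|: O3.
  by apply: (setU3_card cB) => //; rewrite ?cO ?subB.
(* An out-neighbour of [w3] in [S2] would close a 4-walk through [w2] and [x3], and one in [S3]
   would give a 2-cycle. So all [k] of them lie in [S1], which has size [k]. *)
have w3S1 : outset e w3 = S1.
  apply/eqP; rewrite eqEcard !cS // leqnn andbT; apply/subsetP => x xw3.
  have := outA _ _ w3B xw3; rewrite AE !inE -orbA => /or3P[//| xS | xS].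
  + have xS2 : x \in S2 by rewrite inE.
    have w3x : e w3 x by move: xw3; rewrite inE.
    have := no4 _ _ _ _ w3x (arc _ _ _ (SO2 _ xS2) w2O) w2x3.
    by rewrite x3w3.
  + have xS3 : x \in S3 by rewrite inE.
    have := he _ _ (arc _ _ _ (SO3 _ xS3) w3O).
    by move: xw3; rewrite inE => ->.
have OS3 y : y \in O3 -> outset e y = S1.
  by rewrite inE => h; rewrite -w3S1; apply: twins h x3w3.
pose i0 : 'I_3 := inord 0; pose i1 : 'I_3 := inord 1; pose i2 : 'I_3 := inord 2.
(* The final default stands for [S3] and [O3], by [AE] and [BE]. Each S-class shares its colour with
   the O-class it points to. *)
pose c x := if x \in S1 :|: O1 then i0 else if x \in S2 :|: O2 then i1 else i2.
have notin (X Y : {set V}) z : X :&: Y = set0 -> z \in X -> z \in Y = false.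
  by move=> E zX; apply/negP => zY; have := in_set0 z; rewrite -E inE zX zY.
have SA (X : {set V}) x : X \subset A -> x \in X -> x \in B = false.
  by move=> /subsetP sX /sX; apply: disjointFr.
have SB (X : {set V}) x : X \subset B -> x \in X -> x \in A = false.
  by move=> /subsetP sX /sX; apply: disjointFl.
have [sS1 sS2 sS3] : [/\ S1 \subset A, S2 \subset A & S3 \subset A] by rewrite !subA.
have [sO1 sO2 sO3] : [/\ O1 \subset B, O2 \subset B & O3 \subset B] by rewrite !subB.
have i01 : (i0 == i1) = false by rewrite -val_eqE /= !inordK.
have i02 : (i0 == i2) = false by rewrite -val_eqE /= !inordK.
have i12 : (i1 == i2) = false by rewrite -val_eqE /= !inordK.
have notO (X Y : {set V}) x : X \subset A -> Y \subset B -> x \in X -> x \in Y = false.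
  by move=> sX /subsetP sY xX; apply/negP => /sY; rewrite (SA _ _ sX xX).
have notS (X Y : {set V}) x : X \subset A -> Y \subset B -> x \in Y -> x \in X = false.
  by move=> sX sY xY; apply/negP => xX; move: xY; rewrite (notO _ _ _ sX sY xX).
have cS1 x : x \in S1 -> c x = i0 by rewrite /c in_setU => ->.
have cO1 x : x \in O1 -> c x = i0 by rewrite /c in_setU => ->; rewrite orbT.
have cS2 x : x \in S2 -> c x = i1.
  move=> xS; rewrite /c !in_setU (notin S2 S1) 1?setIC // xS.
  by rewrite (notO S2 O1).
have cO2 x : x \in O2 -> c x = i1.
  move=> xO; rewrite /c !in_setU (notin O2 O1) 1?setIC // xO.
  by rewrite (notS S1 O2) ?orbT.
have cS3 x : x \in S3 -> c x = i2.
  move=> xS; rewrite /c !in_setU (notin S3 S1) 1?setIC // (notin S3 S2) 1?setIC //.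
  by rewrite (notO S3 O1) // (notO S3 O2).
have cO3 x : x \in O3 -> c x = i2.
  move=> xO; rewrite /c !in_setU (notin O3 O1) 1?setIC // (notin O3 O2) 1?setIC //.
  by rewrite (notS S1 O3) // (notS S2 O3).
have i10 : (i1 == i0) = false by rewrite eq_sym.
have i20 : (i2 == i0) = false by rewrite eq_sym.
have i21 : (i2 == i1) = false by rewrite eq_sym.
have inS x : x \in A -> [\/ x \in S1, x \in S2 | x \in S3].
  by rewrite AE in_setU in_setU -orbA => /or3P.
have inO x : x \in B -> [\/ x \in O1, x \in O2 | x \in O3].
  by rewrite BE in_setU in_setU -orbA => /or3P.
have class (X Y : {set V}) i : Y \subset X -> (forall x, x \in Y -> c x = i) ->
    (forall x, x \in X -> x \notin Y -> c x != i) -> [set x in X | c x == i] = Y.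
  move=> /subsetP sYX cY nY; apply/setP => x; rewrite !inE.
  apply/andP/idP => [[xX cx] | xY]; last by rewrite sYX // cY.
  by apply/negPn/negP => /(nY _ xX); rewrite cx.
have ES1 : [set x in A | c x == i0] = S1.
  by apply: class => // x /inS[] h;
    [rewrite h | rewrite (cS2 _ h) i10 | rewrite (cS3 _ h) i20].
have ES2 : [set x in A | c x == i1] = S2.
  by apply: class => // x /inS[] h;
    [rewrite (cS1 _ h) i01 | rewrite h | rewrite (cS3 _ h) i21].
have ES3 : [set x in A | c x == i2] = S3.
  by apply: class => // x /inS[] h;
    [rewrite (cS1 _ h) i02 | rewrite (cS2 _ h) i12 | rewrite h].
have EO1 : [set x in B | c x == i0] = O1.
  by apply: class => // x /inO[] h;
    [rewrite h | rewrite (cO2 _ h) i10 | rewrite (cO3 _ h) i20].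
have EO2 : [set x in B | c x == i1] = O2.
  by apply: class => // x /inO[] h;
    [rewrite (cO1 _ h) i01 | rewrite h | rewrite (cO3 _ h) i21].
have EO3 : [set x in B | c x == i2] = O3.
  by apply: class => // x /inO[] h;
    [rewrite (cO1 _ h) i02 | rewrite (cO2 _ h) i12 | rewrite h].
have ord3 (i : 'I_3) : [\/ i = i0, i = i1 | i = i2].
  by case: i => [[|[|[|?]]] ?] //; [apply: Or31 | apply: Or32 | apply: Or33];
    apply: val_inj; rewrite /= inordK.
have next0 : ordS i0 = i1 by apply: val_inj; rewrite /= !inordK.
have next1 : ordS i1 = i2 by apply: val_inj; rewrite /= !inordK.
have next2 : ordS i2 = i0 by apply: val_inj; rewrite /= !inordK.
exists c; last first.
  split=> i; case: (ord3 i) => ->.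
  - by rewrite ES1 cS.
  - by rewrite ES2 cS.
  - by rewrite ES3 cS.
  - by rewrite EO1 cO.
  - by rewrite EO2 cO.
  - by rewrite EO3 cO.
have mem (X Y : {set V}) i y : [set x in X | c x == i] = Y ->
    (y \in Y) = (y \in X) && (c y == i).
  by move=> <-; rewrite inE.
move=> x y; have -> : e x y = (y \in outset e x) by rewrite inE.
have : x \in A :|: B by have [-> _ _] := bip; rewrite inE.
rewrite in_setU => /orP[xA | xB].
- rewrite xA (disjointFr dAB xA) orbF /=; case: (inS _ xA) => h.
  + by rewrite (SO1 _ h) (cS1 _ h) (mem _ _ _ _ EO1).
  + by rewrite (SO2 _ h) (cS2 _ h) (mem _ _ _ _ EO2).
  + by rewrite (SO3 _ h) (cS3 _ h) (mem _ _ _ _ EO3).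
- rewrite xB (disjointFl dAB xB) /=; case: (inO _ xB) => h.
  + by rewrite (OS1 _ h) (cO1 _ h) next0 (mem _ _ _ _ ES2).
  + by rewrite (OS2 _ h) (cO2 _ h) next1 (mem _ _ _ _ ES3).
  + by rewrite (OS3 _ h) (cO3 _ h) next2 (mem _ _ _ _ ES1).
Qed.

(** * Trimming to exact out-degrees, and the conclusion *)

(** The double count needs out-degrees that are constant on each side, so surplus arcs are dropped:
    at each vertex the first [d x] out-neighbours are kept. *)
Lemma exact_outdeg_subrel (V : finType) (e : rel V) (d : V -> nat) :
  (forall x, d x <= outdeg e x) ->
  exists2 e' : rel V, subrel e' e & forall x, outdeg e' x = d x.
Proof.
move=> hd; exists (fun x y => y \in take (d x) (enum (outset e x))).
  by move=> x y /mem_take; rewrite mem_enum inE.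
move=> x; rewrite /outdeg cardsE (card_uniqP (take_uniq _ (enum_uniq _))).
by rewrite size_take_min -cardE; apply/minn_idPl/hd.
Qed.

Theorem theorem9 (V : finType) (e : rel V) (A B : {set V}) (m n : nat)
  (he : oriented e) (hAB : bipartition e A B)
  (hA : #|A| = m) (hB : #|B| = n) (hm : 2 <= m) (hn : 2 <= n)
  (hdA : forall u : V, u \in A -> n <= 3 * outdeg e u)
  (hdB : forall v : V, v \in B -> m <= 3 * outdeg e v) :
  has_dicycle e 4 \/
  [/\ 3 %| m, 3 %| n & digraph_iso e (@Dstar m n)].
Proof.
case: (dicycle4_or_no_closed_4walk he) => [|no4]; [by left | right].
have [AB dAB arcs] := hAB.
(* These are the ceilings of m/3 and n/3, the least out-degrees allowed on [B] and on [A]. *)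
pose k := (m + 2) %/ 3; pose l := (n + 2) %/ 3.
have k0 : 0 < k by rewrite /k; lia.
have l0 : 0 < l by rewrite /l; lia.
have mk : m <= 3 * k by rewrite /k; lia.
have nl : n <= 3 * l by rewrite /l; lia.
have inB x : x \notin A -> x \in B.
  by move=> nA; have := in_setT x; rewrite -AB inE (negPf nA).
have [x | e' sub de'] := @exact_outdeg_subrel _ e (fun x => if x \in A then l else k).
  case: ifPn => [/hdA | /inB /hdB]; rewrite ?/k ?/l; lia.
have dA u : u \in A -> outdeg e' u = l by rewrite de' => ->.
have dB v : v \in B -> outdeg e' v = k by move=> vB; rewrite de' (disjointFl dAB vB).
have no4' : no_closed_4walk e'.
  by move=> a b c d /sub ab /sub bc /sub cd; apply: contra (no4 _ _ _ _ ab bc cd); apply: sub.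
have bip : bipartition e' A B by split=> // x y /sub; apply: arcs.
have bip' := bipartition_sym bip.
have A0 : 0 < #|A| by rewrite hA; lia.
have B0 : 0 < #|B| by rewrite hB; lia.
have mk' : #|A| <= 3 * k by rewrite hA.
have nl' : #|B| <= 3 * l by rewrite hB.
have [cA cB tightB] := pair_count no4' bip dA dB A0 B0 mk' nl'.
(* The degree hypotheses are symmetric in the two sides, so the count also applies to pairs in
   [A]. *)
have [_ _ tightA] := pair_count no4' bip' dB dA B0 A0 nl' mk'.
have twins v x y : e' v x -> e' v y -> outset e' x = outset e' y.
  case: (boolP (v \in A)) => [vA | /inB vB].
    exact: (out_twins no4' bip' dB dA tightA vA).
  exact: (out_twins no4' bip dA dB tightB vB).
have [c col [cardA cardB]] := twins_Dstar_coloring no4' bip k0 l0 cA cB dA dB twins.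
have nonempty (X : {set V}) p : 0 < p -> (forall i, #|[set x in X | c x == i]| = p) ->
    forall i, exists2 x, x \in X & c x = i.
  move=> p0 cX i; have : 0 < #|[set x in X | c x == i]| by rewrite cX.
  by case/card_gt0P=> x; rewrite inE => /andP[xX /eqP cx]; exists x.
(* The colouring found for the trimmed [e'] describes [e] as well, so no arc had in fact been
   dropped. *)
have col' := Dstar_coloring_maximal no4 hAB sub
  (nonempty _ _ k0 cardA) (nonempty _ _ l0 cardB) col.
have iso := Dstar_iso AB dAB k0 l0 cardA cardB col'.
by rewrite -hA -hB cA cB !dvdn_mulr.
Qed.
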